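(* If $A=(A_m)_{m=0}^\infty$ is the Appell sequence determined by $\log f_A(t) = \sum_{k=1}^\infty c_k \frac{t^k}{k!}$, then \[ \mathbb{E}\left(A^2_{\lambda}(x):\lambda\vdash n\right) = \sum_{\lambda \vdash n}\frac{1}{n!}F_\lambda^2 A^2_\lambda(x) = B_n((x+c_1)^2), \] where $B=(B_n)_{n=0}^{\infty}$ is the Appell sequence with $B_1(0)=0$ determined by $\log f_B(t) = \sum_{k=2}^\infty \frac{c_k^2}{(k-1)!} \frac{t^k}{k!}$.
   Context: An Appell sequence is a sequence of polynomials $(A_m)_{m\ge0}$ with $A_0=1$ and $A_m'=mA_{m-1}$ for $m\ge1$; it has exponential generating function $\sum_k A_k(x)t^k/k!=e^{xt}f_A(t)$ for a formal power series $f_A$ with $f_A(0)=1$, and every such $f_A$ determines an Appell sequence. For a partition $\lambda$ of length $r$, let $(n_1,\dots,n_r)=(\lambda_r,\lambda_{r-1}+1,\dots,\lambda_1+r-1)$ and $A_\lambda=\operatorname{Wr}[A_{n_1},\dots,A_{n_r}]/\Delta(n_1,\dots,n_r)$, where $\operatorname{Wr}$ is the Wronskian and $\Delta$ the Vandermonde determinant $\prod_{i<j}(x_j-x_i)$. $F_\lambda$ is the number of standard Young tableaux of shape $\lambda$; the expectation is over Plancherel measure $\mathbb{P}(\lambda)=F_\lambda^2/n!$ on partitions of $n$. *)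

(* Defs.v *)
From HB Require Import structures.
From mathcomp Require Import all_boot all_order all_algebra.
Set Implicit Arguments. Unset Strict Implicit. Unset Printing Implicit Defensive.
Import Order.TTheory GRing.Theory Num.Theory.
Local Open Scope ring_scope.

Section AppellDefs.
Variable R : fieldType.

(* Formal power series are given by their coefficient functions nat -> R. *)

Definition log_series (c : nat -> R) (k : nat) : R :=
  if k is 0 then 0 else c k / (k`!)%:R.

(* Coefficient of t^n in exp(g(t)), for a series g with g_0 = 0:
   only the truncation of g to degree n and the powers g^j, j <= n, matter. *)
Definition trunc_series (g : nat -> R) (n : nat) : {poly R} :=
  \poly_(k < n.+1) g k.

Definition exp_coef (g : nat -> R) (n : nat) : R :=
  (\sum_(j < n.+1) ((j`!)%:R)^-1 *: (trunc_series g n) ^+ j)`_n.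

(* The Appell sequence determined by f (f_0 = 1):
   sum_m A_m(x) t^m/m! = e^{xt} f(t), i.e.
   A_m(x) = sum_{k<=m} m!/(m-k)! f_k x^{m-k}. *)
Definition appell (f : nat -> R) (m : nat) : {poly R} :=
  \sum_(k < m.+1) ((m`!)%:R / ((m - k)`!)%:R * f k) *: 'X^(m - k).

Definition wronskian (r : nat) (P : 'I_r -> {poly R}) : {poly R} :=
  \det (\matrix_(i < r, j < r) (P j)^`(i)).

Definition vdm (r : nat) (a : 'I_r -> nat) : R :=
  \prod_(i < r) \prod_(j < r | (i < j)%N) ((a j)%:R - (a i)%:R).

(* For la = (la_1 >= ... >= la_r) (stored 0-indexed as la`_0 >= ... ),
   (n_1,...,n_r) = (la_r, la_{r-1}+1, ..., la_1 + r - 1); 0-indexed: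
   n_i = la_{r-1-i} + i. *)
Definition shift_seq (la : seq nat) (i : 'I_(size la)) : nat :=
  (nth 0 la (size la - i.+1) + i)%N.

Definition appell_schur (A : nat -> {poly R}) (la : seq nat) : {poly R} :=
  (vdm (@shift_seq la))^-1 *: wronskian (fun j => A (@shift_seq la j)).

End AppellDefs.

Definition is_partition (n : nat) (la : seq nat) : bool :=
  [&& sorted geq la, all (fun x => 0 < x)%N la & sumn la == n].

Definition partitions (n : nat) : seq (seq nat) :=
  undup [seq la <- [seq [seq val i | i <- tval t & (0 < val i)%N]
                    | t : n.-tuple 'I_n.+1] | is_partition n la].

Definition in_shape (la : seq nat) (c : nat * nat) : bool :=
  (c.1 < size la)%N && (c.2 < nth 0 la c.1)%N.

(* A standard Young tableau of shape la (n = |la|), described by the map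
   sending the entry k (k = 0..n-1) to the cell containing it: a bijection
   onto the cells of la, with entries increasing along rows and columns. *)
Definition is_syt (la : seq nat) (n : nat) (T : {ffun 'I_n -> 'I_n * 'I_n}) : bool :=
  [&& injectiveb T,
      [forall k, in_shape la (val (T k).1, val (T k).2)] &
      [forall k, forall l,
         (((val (T l).1 == val (T k).1) && (val (T l).2 == (val (T k).2).+1))
          || ((val (T l).1 == (val (T k).1).+1) && (val (T l).2 == val (T k).2)))
         ==> (k < l)%N]].

Definition num_syt (la : seq nat) : nat :=
  #|[pred T : {ffun 'I_(sumn la) -> 'I_(sumn la) * 'I_(sumn la)} | is_syt la T]|.

(* Main.v *)
(** Put [h_m = A_m / m!], [p_1 = x + c_1] and [p_k = c_k / (k-1)!] for [k > 1].
Then [m h_m = sum_k p_k h_(m-k)], so the [h_m] and [p_k] behave as complete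
symmetric functions and power sums, and the Wronskian becomes a Jacobi-Trudi
determinant. Since [F_la = n! Delta / prod_j n_j!], one gets
[F_la A_la = n! s_la], and the claim is the Cauchy identity
[sum_la s_la^2 = [t^n] exp (sum_k p_k^2 t^k / k)].

The Cauchy identity follows from a recursion. Writing
[S a = det (h_(a_i - j))], Euler's identity reads
[n S a = sum_k p_k sum_i S (a - k e_i)], while multiplication by a power sum is
[p_k S b = sum_i S (b + k e_i)] as soon as [0, ..., k-1] occur among the [b_i].
Summing [S a ^ 2] over all exponent vectors [a], sorted or not (each partition
is then counted [N!] times up to sign, and the square kills the sign), shows that
[Z_n = sum_la s_la^2] satisfies [n Z_n = sum_k p_k^2 Z_(n-k)], which is the
recursion of [B_n / n!] at [(x + c_1)^2].

Frobenius' formula for [F_la] comes from Euler's identity for [h_m = 1 / m!],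
[p = (1, 0, 0, ...)], which is the branching rule of standard tableaux. *)

Require Import Defs.
From mathcomp Require Import all_boot all_order all_fingroup all_algebra.
From mathcomp Require Import zify ring.
Set Implicit Arguments.
Unset Strict Implicit.
Unset Printing Implicit Defensive.
Import Order.TTheory GRing.Theory Num.Theory.
Local Open Scope ring_scope.

(** * Jacobi-Trudi determinants *)

Definition update (N : nat) (a : 'I_N -> nat) (i : 'I_N) (v : nat) : 'I_N -> nat :=
  fun l => if l == i then v else a l.

Section JacobiTrudi.
Variable K : comNzRingType.
Implicit Types (h p e : nat -> K).

(** This is [h_(a - b)] with the convention that negative indices give 0, which truncated
    subtraction alone would not provide. *)
Definition hsub h (a b : nat) : K := if (b <= a)%N then h (a - b)%N else 0.

Definition jt_mx N h (a : 'I_N -> nat) : 'M[K]_N := \matrix_(i, j) hsub h (a i) j.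

(* For increasing exponents [a i = la_(N - i) + i] this is the Jacobi-Trudi
   determinant of the Schur function [s_la]. *)
Definition schur N h (a : 'I_N -> nat) : K := \det (jt_mx h a).

(* [p k] stands for the power sum of degree [k + 1]. *)
Definition newton h p :=
  forall m, m%:R * h m = \sum_(k < m) p k * h (m - k.+1)%N.

Lemma eq_schur N h (a b : 'I_N -> nat) : a =1 b -> schur h a = schur h b.
Proof. by move=> e; congr (\det _); apply/matrixP => i j; rewrite !mxE e. Qed.

Lemma det_row_update N (A : 'M[K]_N) i (v : 'I_N -> K) :
  \det (\matrix_(l, j) if l == i then v j else A l j)
  = \sum_j v j * cofactor A i j.
Proof.
rewrite (expand_det_row _ i); apply: eq_bigr => j _; rewrite mxE eqxx.
congr (_ * (_ * \det _)); apply/matrixP => k l; rewrite !mxE.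
by rewrite eq_sym (negbTE (neq_lift _ _)).
Qed.

Lemma schur_update N h (a : 'I_N -> nat) i v :
  schur h (update a i v) = \sum_(j < N) hsub h v j * cofactor (jt_mx h a) i j.
Proof.
rewrite -det_row_update; congr (\det _); apply/matrixP => l j.
by rewrite !mxE /update; case: eqP.
Qed.

Lemma schur_perm N h (a : 'I_N -> nat) (s : 'S_N) :
  schur h (a \o s) = (-1) ^+ s * schur h a.
Proof.
rewrite /schur -det_perm -det_mulmx -row_permE; congr (\det _).
by apply/matrixP => i j; rewrite !mxE.
Qed.

Lemma schur_eq0 N h (a : 'I_N -> nat) i j :
  i != j -> a i = a j -> schur h a = 0.
Proof.
by move=> nij eaij; apply: (determinant_alternate nij) => l; rewrite !mxE eaij.
Qed.

Lemma schur_neq0_inj N h (a : 'I_N -> nat) : schur h a != 0 -> injective a.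
Proof.
move=> nz i j eij; apply/eqP; apply: contraNT nz => nij.
by rewrite (schur_eq0 h nij eij).
Qed.

(** This is Newton's recursion at degree [a - j]; the terms with [a - j <= k < a] vanish by the
    convention in [hsub]. The range [k < a] no longer depends on the column [j]. *)
Lemma newton_hsub h p L a j : newton h p -> (a <= L)%N ->
  \sum_(k < L | (k < a)%N) p k * hsub h (a - k.+1) j
  = (a%:R - j%:R) * hsub h a j.
Proof.
move=> hp leaL; rewrite /hsub; case: leqP => [leja|ltaj]; last first.
  rewrite mulr0 big1 // => k _; case: ifP; rewrite ?mulr0 //; lia.
rewrite -natrB // hp (big_ord_widen L (fun k => p k * h (a - j - k.+1)%N)); last lia.
rewrite big_mkcond [RHS]big_mkcond; apply: eq_bigr => k _.
case: ifP => h1; case: ifP => h2 //; try by exfalso; lia.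
- by rewrite ifT; [congr (_ * h _)|]; lia.
- by rewrite ifF ?mulr0 //; lia.
Qed.

(* Euler's identity [n s_la = sum_k p_k (k d/dp_k) s_la]. *)
Lemma schur_euler N h p (a : 'I_N -> nat) L : newton h p ->
  (forall i, a i <= L)%N ->
  ((\sum_i a i)%:R - (\sum_(i < N) i)%:R) * schur h a =
  \sum_(k < L) p k * \sum_(i | (k < a i)%N) schur h (update a i (a i - k.+1)).
Proof.
move=> hp leaL.
under [RHS]eq_bigr do rewrite mulr_sumr big_mkcond.
rewrite exchange_big /=.
have E i : \sum_(k < L) (if (k < a i)%N
     then p k * schur h (update a i (a i - k.+1)) else 0) =
   \sum_(j < N) ((a i)%:R - j%:R) * (hsub h (a i) j * cofactor (jt_mx h a) i j).
  rewrite -big_mkcond /=.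
  under eq_bigr do rewrite schur_update mulr_sumr.
  rewrite exchange_big /=; apply: eq_bigr => j _.
  rewrite mulrA -(newton_hsub j hp (leaL i)) mulr_suml.
  by apply: eq_bigr => k _; rewrite mulrA.
under [RHS]eq_bigr do rewrite E.
(* Split the factor [a i - j]: the [a i] half is a Laplace expansion along row [i], the [j] half one
   along column [j], so each gives a multiple of the determinant. *)
under [RHS]eq_bigr => i _.
  under eq_bigr do rewrite mulrBl.
  rewrite sumrB.
  over.
rewrite sumrB [X in _ = _ - X]exchange_big /= mulrBl !natr_sum !mulr_suml.
congr (_ - _); apply: eq_bigr => i _; rewrite -mulr_sumr; congr (_ * _).
- by rewrite /schur (expand_det_row _ i); apply: eq_bigr => j _; rewrite mxE.
- by rewrite /schur (expand_det_col _ i); apply: eq_bigr => j _; rewrite mxE.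
Qed.

(** [e] is the inverse power series of [h] up to degree [M]; since [h 0 = 1], each new coefficient
    is forced by the earlier ones. *)
Lemma conv_inverse h : h 0%N = 1 -> forall M, exists e : nat -> K,
  forall n, (n < M)%N -> \sum_(d < n.+1) e d * h (n - d)%N = (n == 0%N)%:R.
Proof.
move=> h0; elim=> [|M [e eP]]; first by exists (fun=> 0).
pose v := (M == 0%N)%:R - \sum_(d < M) e d * h (M - d)%N.
exists (fun d => if d == M then v else e d) => n.
rewrite ltnS leq_eqVlt => /orP[/eqP->|ltnM].
  rewrite big_ord_recr /= eqxx subnn h0 mulr1 -[RHS](subrK (\sum_(d < M) e d * h (M - d)%N)).
  rewrite -/v addrC; congr (_ + _); apply: eq_bigr => d _.
  by rewrite ltn_eqF.
rewrite -eP //; apply: eq_bigr => d _; rewrite ltn_eqF //.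
by have := ltn_ord d; lia.
Qed.

(** Exchanging the sums gives the coefficient of [t^(k+1)] in [e(t) t h'(t)]. With [e = 1/h] this is
    the logarithmic derivative, whose coefficients are the [p k]. *)
Lemma newton_inverse h p e k : newton h p ->
  (forall n, (n <= k)%N -> \sum_(d < n.+1) e d * h (n - d)%N = (n == 0%N)%:R) ->
  \sum_(j < k.+1) \sum_(d < j.+1) e d * h (k.+1 - d)%N = p k.
Proof.
move=> hp eP.
have -> : \sum_(j < k.+1) \sum_(d < j.+1) e d * h (k.+1 - d)%N
    = \sum_(d < k.+1) e d * ((k.+1 - d)%:R * h (k.+1 - d)%N).
  transitivity (\sum_(j < k.+1) \sum_(d < k.+1 | (d < j.+1)%N)
       e d * h (k.+1 - d)%N).
    apply: eq_bigr => j _.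
    rewrite (big_ord_widen k.+1 (fun d => e d * h (k.+1 - d)%N)) //.
  rewrite (exchange_big_dep predT) //=; apply: eq_bigr => d _.
  transitivity (\sum_(d <= j < k.+1) e d * h (k.+1 - d)%N).
    by rewrite big_geq_mkord; apply: eq_bigl => j; rewrite ltnS.
  by rewrite sumr_const_nat -[LHS]mulr_natl mulrCA.
under eq_bigr do rewrite hp mulr_sumr.
transitivity (\sum_(d < k.+1) \sum_(l < k.+1 | (l < k.+1 - d)%N)
   e d * (p l * h (k.+1 - d - l.+1)%N)).
  apply: eq_bigr => d _.
  rewrite (big_ord_widen k.+1 (fun l => e d * (p l * h (k.+1 - d - l.+1)%N))) //.
  by rewrite leq_subr.
(* Only [l = k] survives: for [l < k] the inner sum is the coefficient of positive degree [k - l] in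
   [e h = 1]. *)
rewrite (exchange_big_dep predT) //= big_ord_recr /= [X in X + _]big1 => [|l _].
  rewrite add0r (bigD1 ord0) /=; last lia.
  rewrite big1 => [|d]; last by rewrite -val_eqE /=; lia.
  have /(_ isT) := eP 0%N; rewrite big_ord1 addr0 subn0 subnn eqxx => e0.
  by rewrite mulrCA e0 mulr1.
transitivity (p l * \sum_(d < (k - l).+1) e d * h (k - l - d)%N); last first.
  rewrite eP; last by rewrite leq_subr.
  by have := ltn_ord l; rewrite subn_eq0; case: leqP => //; rewrite mulr0.
rewrite mulr_sumr.
rewrite (big_ord_widen k.+1 (fun d => p l * (e d * h (k - l - d)%N))); last lia.
apply: eq_big => d; first by have := ltn_ord l; have := ltn_ord d; lia.
by move=> _; rewrite mulrCA; congr (_ * (_ * h _)); lia.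
Qed.

Lemma sum_inj_initial N (b : 'I_N -> nat) j (F : nat -> K) : injective b ->
  (forall v, (v <= j)%N -> exists i, b i = v) ->
  \sum_(i | (b i <= j)%N) F (b i) = \sum_(v < j.+1) F v.
Proof.
move=> b_inj b_im; rewrite -(big_mkord predT F) /index_iota subn0.
rewrite -(big_map b (fun v => (v <= j)%N) F) -big_filter; apply: perm_big.
apply: uniq_perm; rewrite ?filter_uniq ?iota_uniq //.
  by rewrite map_inj_uniq // index_enum_uniq.
move=> v; rewrite mem_filter mem_iota /= add0n ltnS.
case: leqP => //= lev; have [i <-] := b_im v lev.
by rewrite map_f // mem_index_enum.
Qed.

(* The first [k + 1] rows of the adjugate are explicit, because the exponents
   [0, ..., k] occur among the [b i]. *)
Lemma schur_mul_power_sum N h p (b : 'I_N -> nat) k : newton h p -> h 0%N = 1 ->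
  (k < N)%N -> injective b -> (forall v, (v <= k)%N -> exists i, b i = v) ->
  \sum_i schur h (update b i (b i + k.+1)) = p k * schur h b.
Proof.
move=> hp h0 ltkN b_inj b_im.
have [e eP] := conv_inverse h0 k.+1.
set A := jt_mx h b.
(* [u j] is the candidate row [j] of the inverse of [A]: its product with column [l] runs over the
   exponents [v <= j] and is the coefficient of degree [j - l] in [e h]. *)
pose u (j : 'I_N) : 'rV[K]_N :=
  \row_i if (b i <= j)%N then e (j - b i)%N else 0.
have uA (j : 'I_N) : (j <= k)%N -> u j *m A = delta_mx 0 j.
  move=> lejk; apply/rowP => l; rewrite !mxE eqxx /=.
  transitivity (\sum_(i | (b i <= j)%N) (e (j - b i)%N * hsub h (b i) l)).
    rewrite [RHS]big_mkcond; apply: eq_bigr => i _; rewrite !mxE.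
    by case: ifP => // _; rewrite mul0r.
  rewrite (@sum_inj_initial _ b j (fun v => e (j - v)%N * hsub h v l)) //; last first.
    by move=> v hv; apply: b_im; lia.
  have [ltjl|lelj] := ltnP j l.
    rewrite big1 => [|v _]; first by rewrite eq_sym -val_eqE ltn_eqF.
    rewrite /hsub; case: leqP; rewrite ?mulr0 //; have := ltn_ord v; lia.
  have -> : (l == j) = ((j - l)%N == 0%N) by rewrite -val_eqE /=; lia.
  rewrite -eP; last lia.
  rewrite (big_ord_widen j.+1 (fun d => e d * h (j - l - d)%N)); last lia.
  rewrite (reindex_inj rev_ord_inj) /= [RHS]big_mkcond.
  apply: eq_bigr => v _; rewrite subSS /hsub.
  have -> : (j - (j - v) = v)%N by have := ltn_ord v; lia.
  have -> : (v < (j - l).+1)%N = (l <= j - v)%N by have := ltn_ord v; lia.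
  case: ifP; rewrite ?mulr0 // => _; congr (_ * h _); lia.
(* Multiplying [u j *m A = delta_mx 0 j] by the adjugate avoids any division by the determinant. *)
have adjE (j i : 'I_N) : (j <= k)%N -> cofactor A i j = \det A * u j 0 i.
  move=> lejk; have /(congr1 (fun M => (M *m \adj A) 0 i)) := uA j lejk.
  rewrite -mulmxA mul_mx_adj mul_mx_scalar mxE => ->.
  by rewrite -rowE !mxE.
transitivity (\sum_(j < N) \sum_i hsub h (b i + k.+1) j * cofactor A i j).
  by rewrite [RHS]exchange_big; apply: eq_bigr => i _; rewrite schur_update.
(* For [j > k], raising the exponents by [k + 1] amounts to reading column [j - k - 1] of [A], so
   the sum is an off-diagonal entry of [\adj A *m A]. *)
rewrite (bigID (fun j : 'I_N => (j <= k)%N)) /= [X in _ + X]big1 => [|j]; last first.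
  rewrite -ltnNge => ltkj.
  have ltj' : (j - k.+1 < N)%N by have := ltn_ord j; lia.
  pose j' := Ordinal ltj'.
  have := congr1 (fun M : 'M[K]_N => M j j') (mul_adj_mx A); rewrite !mxE.
  have -> : (j == j') = false by rewrite -val_eqE /=; lia.
  rewrite mulr0n => adj0; rewrite -[RHS]adj0.
  apply: eq_bigr => i _; rewrite !mxE mulrC; congr (_ * _).
  rewrite /hsub /=; have -> : (j <= b i + k.+1)%N = (j - k.+1 <= b i)%N by lia.
  by case: ifP => // hle; congr h; lia.
rewrite addr0.
transitivity (\sum_(j < N | (j <= k)%N)
   (\sum_(d < j.+1) e d * h (k.+1 - d)%N) * \det A).
  apply: eq_bigr => j lejk.
  transitivity (\sum_(i | (b i <= j)%N)
      (hsub h (b i + k.+1) j * e (j - b i)%N) * \det A).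
    rewrite [RHS]big_mkcond; apply: eq_bigr => i _; rewrite adjE // mxE.
    by case: ifP => _; rewrite ?mulr0 // -mulrA [_ * \det A]mulrC.
  rewrite -mulr_suml (@sum_inj_initial _ b j
     (fun v => hsub h (v + k.+1) j * e (j - v)%N)) //; last first.
    by move=> v hv; apply: b_im; lia.
  congr (_ * _); rewrite (reindex_inj rev_ord_inj) /=.
  apply: eq_bigr => d _; have := ltn_ord d => ltd; rewrite mulrC subSS.
  have -> : (j - (j - d) = d)%N by lia.
  by congr (_ * _); rewrite /hsub ifT; [congr h|]; lia.
rewrite -mulr_suml -(newton_inverse hp eP); congr (_ * _).
by rewrite (big_ord_widen N (fun j => \sum_(d < j.+1) e d * h (k.+1 - d)%N)).
Qed.

(** A new smallest exponent 0, the others being raised by 1, adds a zero part to the partition; the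
    new first row is [(1, 0, ..., 0)]. *)
Lemma schur_pad N h (a : 'I_N -> nat) (b : 'I_N.+1 -> nat) : h 0%N = 1 ->
  b ord0 = 0%N -> (forall i, b (lift ord0 i) = (a i).+1) -> schur h b = schur h a.
Proof.
move=> h0 b0 bS; rewrite /schur (expand_det_row _ ord0) big_ord_recl !mxE b0.
rewrite big1 => [|j _]; last by rewrite mxE b0 /hsub /= mul0r.
rewrite /hsub /= h0 mul1r addr0 /cofactor expr0 mul1r; congr (\det _).
by apply/matrixP => i j; rewrite !mxE /hsub bS ltnS subSS.
Qed.

Lemma schur_id N h : h 0%N = 1 -> schur h (fun i : 'I_N => i : nat) = 1.
Proof.
move=> h0; rewrite /schur det_trig; first by rewrite big1 // => i _; rewrite mxE /hsub leqnn subnn.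
by apply/is_trig_mxP => i j ltij; rewrite mxE /hsub leqNgt ltij.
Qed.

End JacobiTrudi.

(** * The recursion for sums of squares *)


(** By pigeonhole some entry is at least [size s - 1]; remove it and induct. *)
Lemma sum_uniq_ge (s : seq nat) : uniq s -> (\sum_(i < size s) i <= sumn s)%N.
Proof.
move: {2}(size s) (erefl (size s)) => n; elim: n s => [|n IHn] s sz us.
  by rewrite sz big_ord0.
have /hasP[x xs lenx] : has (leq n) s.
  apply: contraT; rewrite -all_predC => /allP sn.
  have : (size s <= size (iota 0 n))%N.
    apply: uniq_leq_size us _ => x xs; rewrite mem_iota /= add0n ltnNge.
    exact: sn.
  by rewrite size_iota sz ltnn.
have sz' : size (rem x s) = n by rewrite size_rem // sz.
have := IHn _ sz' (rem_uniq x us); rewrite sz' => le_rem.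
by rewrite sz big_ord_recr /= (perm_sumn (perm_to_rem xs)) /= addnC leq_add.
Qed.

Lemma sum_inj_ge N (a : 'I_N -> nat) : injective a ->
  (\sum_(i < N) i <= \sum_i a i)%N.
Proof.
move=> a_inj; have := @sum_uniq_ge (map a (enum 'I_N)).
rewrite map_inj_uniq // enum_uniq => /(_ isT).
by rewrite size_map size_enum_ord sumnE big_map big_enum.
Qed.

(** If [v] were missing, adjoining it would give [N + 1] distinct numbers with too small a sum. *)
Lemma sum_inj_initial_im N (a : 'I_N -> nat) v : injective a ->
  (v + \sum_i a i < \sum_(i < N) i + N)%N -> exists i, a i = v.
Proof.
move=> a_inj lt_sum; suff /mapP[i _ ->] : v \in map a (enum 'I_N) by exists i.
apply: contraT => vNa; have := @sum_uniq_ge (v :: map a (enum 'I_N)).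
rewrite /= vNa map_inj_uniq // enum_uniq => /(_ isT).
by rewrite size_map size_enum_ord sumnE big_map big_enum big_ord_recr /= leqNgt lt_sum.
Qed.

Lemma sum_update N (a : 'I_N -> nat) i v :
  (\sum_l update a i v l + a i = \sum_l a l + v)%N.
Proof.
rewrite (bigD1 i) //= [X in (_ = X + _)%N](bigD1 i) //= {1}/update eqxx.
rewrite (eq_bigr (fun l => a l)); last by move=> l /negbTE; rewrite /update => ->.
lia.
Qed.

Section WeightSum.
Variables (K : comNzRingType) (N : nat) (h p : nat -> K).
Hypotheses (hp : newton h p) (h0 : h 0%N = 1).

Let wt0 := (\sum_(i < N) i)%N.
(** Bounding the exponents makes the vectors a finite type; no entry of a vector of weight at most
    [wt0 + N] reaches [L]. *)
Let L := (wt0 + N).+1.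
Let fval (a : {ffun 'I_N -> 'I_L}) : 'I_N -> nat := fun i => a i.
Let fupd (a : {ffun 'I_N -> 'I_L}) (i : 'I_N) v : {ffun 'I_N -> 'I_L} :=
  [ffun l => if l == i then inord v else a l].

Lemma schur_light (a : 'I_N -> nat) : (\sum_i a i < wt0)%N -> schur h a = 0.
Proof.
move=> lt_wt; apply/eqP; apply: contraLR lt_wt => /schur_neq0_inj /sum_inj_ge.
by rewrite -leqNgt.
Qed.

Let fval_upd a i v : (v < L)%N -> fval (fupd a i v) =1 update (fval a) i v.
Proof.
by move=> ltv l; rewrite /fval /fupd /update ffunE; case: eqP => // _; rewrite inordK.
Qed.

Let wt_upd a i v : (v < L)%N ->
  (\sum_l fval (fupd a i v) l + a i = \sum_l fval a l + v)%N.
Proof.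
move=> ltv; rewrite -(sum_update (fval a) i); congr (_ + _)%N.
by apply: eq_bigr => l _; apply: fval_upd.
Qed.

Let fupdK a i u v : fupd (fupd a i u) i v = fupd a i v.
Proof. by apply/ffunP => l; rewrite !ffunE; case: eqP. Qed.

Let fupd_id (a : {ffun 'I_N -> 'I_L}) i v : v = a i :> nat -> fupd a i v = a.
Proof.
move=> ->; apply/ffunP => l; rewrite !ffunE; case: eqP => // ->.
by apply: val_inj; rewrite /= inordK.
Qed.

(** All vectors are summed, not only increasing ones, so that shifting one coordinate reindexes the
    sum without any re-sorting. *)
Definition schur_sq_sum n : K :=
  \sum_(a : {ffun 'I_N -> 'I_L} | (\sum_i fval a i == n + wt0)%N)
     schur h (fval a) ^+ 2.

(** Euler's identity lowers one exponent in one factor of the square; substituting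
    [c = a - (k+1) e_i] turns this into raising an exponent in the other factor, where the sum over
    [i] is multiplication by [p k]. *)
Lemma schur_sq_sum_rec n : (n <= N)%N ->
  n%:R * schur_sq_sum n = \sum_(k < n) p k ^+ 2 * schur_sq_sum (n - k.+1).
Proof.
move=> lenN.
have E1 (a : {ffun 'I_N -> 'I_L}) : (\sum_i fval a i == n + wt0)%N ->
  n%:R * schur h (fval a) ^+ 2 = \sum_(k < L) \sum_i
    if (k < a i)%N then p k * (schur h (fval a) *
       schur h (update (fval a) i (a i - k.+1))) else 0.
  move=> /eqP wta; have leaL i : (fval a i <= L)%N by apply: ltnW; apply: ltn_ord.
  have := schur_euler hp leaL; rewrite wta natrD addrK => Eu.
  rewrite expr2 mulrA Eu mulr_suml; apply: eq_bigr => k _.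
  rewrite -big_mkcond /=; move: (schur h (fval a)) => s; rewrite mulr_sumr mulr_suml; apply: eq_bigr => i _.
  by rewrite -!mulrA; congr (_ * _); apply: mulrC.
rewrite /schur_sq_sum mulr_sumr (eq_bigr _ E1) exchange_big /=.
have E2 (k : 'I_L) (i : 'I_N) :
  \sum_(a : {ffun 'I_N -> 'I_L} | (\sum_i fval a i == n + wt0)%N)
    (if (k < a i)%N then p k * (schur h (fval a) *
       schur h (update (fval a) i (a i - k.+1))) else 0) =
  \sum_(c : {ffun 'I_N -> 'I_L} | (\sum_i fval c i + k.+1 == n + wt0)%N)
    p k * (schur h (fval c) * schur h (update (fval c) i (c i + k.+1))).
  rewrite -big_mkcondr /=.
  rewrite (reindex_onto (fun c => fupd c i (c i + k.+1))
                        (fun a => fupd a i (a i - k.+1))) /=; last first.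
    move=> a /andP[_ ltk]; have lta : (a i - k.+1 < L)%N by have := ltn_ord (a i); lia.
    rewrite fupdK // fupd_id // ffunE eqxx inordK //; lia.
  apply: eq_big => [c|c /andP[/andP[_ ltk] _]].
    have [ltc|gec] := ltnP (c i + k.+1) L.
      have := wt_upd c i ltc.
      rewrite fupdK [fupd c i _ i]ffunE eqxx inordK // addnK (fupd_id (erefl (c i : nat))).
      rewrite eqxx andbT leq_addl andbT.
      move: (\sum_l fval _ l)%N (\sum_l fval c l)%N => x y E.
      by apply/eqP/eqP; lia.
    (* On overflow [inord] returns 0, so [k < a i] fails on the left; on the right the weight would
       be at least [L], hence more than [n + wt0]. *)
    have -> : fupd c i (c i + k.+1) i = ord0.
      by rewrite ffunE eqxx; apply: val_inj; rewrite /= /inord val_insubd ltnNge gec.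
    rewrite ltn0 andbF /=; apply/esym/negbTE.
    have : (c i <= \sum_i fval c i)%N by rewrite (bigD1 i) //= leq_addr.
    by move: (\sum_i _)%N gec => x; rewrite /L; lia.
  have ltc : (c i + k.+1 < L)%N.
    rewrite ltnNge; apply/negP => gec; move: ltk.
    by rewrite ffunE eqxx /inord val_insubd ifN -?leqNgt.
  rewrite (eq_schur h (fval_upd c i ltc)); congr (_ * _); rewrite mulrC.
  congr (_ * _); apply: eq_schur => l; rewrite /update ffunE eqxx inordK //.
  case: eqP => [->|nli]; first by rewrite /fval; lia.
  by rewrite /fval ffunE; case: eqP.
under eq_bigr => k _.
  rewrite exchange_big /=.
  under eq_bigr do rewrite E2.
  rewrite exchange_big /=.
  over.
have ltnL : (n <= L)%N by rewrite /L; lia.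
(* For [k >= n] the weight of [c] is below the minimum [wt0], so its determinant vanishes. *)
rewrite /= (bigID (fun k : 'I_L => (k < n)%N)) /= [X in _ + X]big1 ?addr0; last first.
  move=> k; rewrite -leqNgt => lenk; apply: big1 => c /eqP wtc.
  apply: big1 => i _; rewrite schur_light ?mul0r ?mulr0 //.
  by move: (\sum_l _)%N wtc => x; lia.
rewrite (big_ord_widen L (fun k => p k ^+ 2 * schur_sq_sum (n - k.+1))) //.
apply: eq_bigr => k ltkn; rewrite /schur_sq_sum mulr_sumr; apply: eq_big => [c|c /eqP wtc].
  by move: (\sum_l _)%N => x; apply/eqP/eqP; lia.
rewrite -mulr_sumr -mulr_sumr.
(* A nonzero determinant forces distinct exponents; then [n <= N] and the weight of [c] force
   [0, ..., k] to occur among them. *)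
have [->|nz] := eqVneq (schur h (fval c)) 0; first by rewrite expr0n mul0r !mulr0.
have c_inj := schur_neq0_inj nz.
rewrite (schur_mul_power_sum hp) //; last 2 first.
- lia.
- move=> v lev; apply: sum_inj_initial_im => //.
  by rewrite -/wt0; move: (\sum_l _)%N wtc => x; lia.
by ring.
Qed.

End WeightSum.

(** * Exponent vectors of partitions *)


(** Unlike [shift_seq], the number of rows [N] is independent of [la], which is padded with zero
    parts. *)
Definition part_exp N (la : seq nat) (i : 'I_N) : nat :=
  (nth 0 la (N - i.+1) + i)%N.

Lemma sumn_nth N (la : seq nat) : (size la <= N)%N ->
  (\sum_(i < N) nth 0 la i = sumn la)%N.
Proof.
move=> sz; rewrite sumnE (big_nth 0%N) big_mkord [RHS](big_ord_widen N (nth 0%N la)) //.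
rewrite [RHS]big_mkcond; apply: eq_bigr => i _.
by case: ltnP => // le_sz; rewrite nth_default.
Qed.

Lemma sum_part_exp N (la : seq nat) : (size la <= N)%N ->
  (\sum_(i < N) part_exp la i = sumn la + \sum_(i < N) i)%N.
Proof.
move=> sz; rewrite big_split /=; congr (_ + _)%N.
by rewrite -(sumn_nth sz) [RHS](reindex_inj rev_ord_inj).
Qed.

Lemma sorted_geq_nth (la : seq nat) i j : sorted geq la -> (i <= j)%N ->
  (nth 0 la j <= nth 0 la i)%N.
Proof.
move=> srt leij; have [ltj|] := ltnP j (size la); last by move=> ?; rewrite nth_default.
have tr : transitive geq by move=> x y z /= h1 h2; apply: leq_trans h2 h1.
have rf : reflexive geq by move=> x; apply: leqnn.
by apply: (sorted_leq_nth tr rf 0%N srt) => //; rewrite inE //; apply: leq_ltn_trans ltj.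
Qed.

Lemma part_exp_lt N (la : seq nat) (i j : 'I_N) : sorted geq la -> (i < j)%N ->
  (part_exp la i < part_exp la j)%N.
Proof.
move=> srt ltij; rewrite /part_exp.
have : (nth 0 la (N - i.+1) <= nth 0 la (N - j.+1))%N.
  by apply: sorted_geq_nth => //; lia.
lia.
Qed.

Lemma part_exp_inj N (la : seq nat) : sorted geq la -> injective (@part_exp N la).
Proof.
move=> srt i j eij; apply: val_inj; case: (ltngtP i j) => //= lt;
  by have := part_exp_lt srt lt; rewrite eij ltnn.
Qed.

Lemma is_partition_size n la : is_partition n la -> (size la <= n)%N.
Proof.
case/and3P=> _ pos /eqP <-; elim: la pos => //= x la IH /andP[x0 /IH]; lia.
Qed.

Lemma eq_pos_nth (la mu : seq nat) : all (fun x => 0 < x)%N la ->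
  all (fun x => 0 < x)%N mu -> (forall i, nth 0 la i = nth 0 mu i)%N -> la = mu.
Proof.
elim: la mu => [|x la IH] [|y mu] //=.
- by move=> _ /andP[y0 _] /(_ 0%N) /= e; rewrite -e in y0.
- by move=> /andP[x0 _] _ /(_ 0%N) /= e; rewrite e in x0.
- move=> /andP[_ pla] /andP[_ pmu] e; have /= -> := e 0%N.
  by rewrite (IH mu) // => i; have := e i.+1.
Qed.

Lemma nth_filter_pos (s : seq nat) i : sorted geq s ->
  nth 0%N [seq x <- s | (0 < x)%N] i = nth 0%N s i.
Proof.
elim: s i => //= x s IH i pth; have srt := path_sorted pth.
case: posnP => [x0|_]; last by case: i => //= i; apply: IH.
have nth0 j : nth 0%N (x :: s) j = 0%N.
  by apply/eqP; rewrite -leqn0 -[X in (_ <= X)%N]x0; apply: (@sorted_geq_nth (x :: s) 0 j).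
by rewrite nth0 IH //; exact: (nth0 i.+1).
Qed.

Lemma mem_partitions n la : (la \in partitions n) = is_partition n la.
Proof.
rewrite mem_undup mem_filter; case: (boolP (is_partition n la)) => //= part.
have sz := is_partition_size part; case/and3P: part => srt pos /eqP sum.
(* The tuple producing [la] is [la] padded with zeros to length [n]; the filter on positive entries
   removes them. *)
have szp : size (map (@inord n) (la ++ nseq (n - size la) 0%N)) == n.
  by rewrite size_map size_cat size_nseq subnKC.
apply/mapP; exists (Tuple szp); first by rewrite mem_enum.
have le_n x : x \in la -> (x < n.+1)%N.
  by move=> /perm_to_rem/perm_sumn; rewrite sum /= ltnS => ->; apply: leq_addr.
rewrite /= map_cat filter_cat map_cat.
have -> : [seq i <- map (@inord n) (nseq (n - size la) 0%N) | (0 < val i)%N] = [::].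
  by elim: (n - size la)%N => //= m IH; rewrite inordK //= IH.
rewrite cats0 filter_map -map_comp.
have -> : [seq x <- la | preim (@inord n) (fun i => 0 < val i)%N x] = la.
  apply/all_filterP/allP => x xla /=; rewrite inordK; last exact: le_n.
  exact: (allP pos).
rewrite -[LHS]map_id; apply/eq_in_map => x xla /=; rewrite inordK //; exact: le_n.
Qed.

(** Sort the values into [t]. Strict increase gives [t_i >= i], and the differences [t_i - i], read
    from the top with zeros dropped, are the parts. *)
Lemma partition_of_inj N n (a : 'I_N -> nat) : injective a ->
  (\sum_i a i = n + \sum_(i < N) i)%N ->
  exists2 la, is_partition n la & exists s : 'S_N, a =1 @part_exp N la \o s.
Proof.
move=> a_inj wta; set s := map a (enum 'I_N).
set t := sort leq s.
have pst : perm_eq t s by rewrite perm_sort.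
have szt : size t = N by rewrite size_sort size_map size_enum_ord.
have srt : sorted ltn t.
  rewrite ltn_sorted_uniq_leq sort_uniq map_inj_uniq // enum_uniq /=.
  exact: (sort_sorted leq_total).
have t_incr i j : (i < j)%N -> (j < N)%N -> (nth 0 t i < nth 0 t j)%N.
  move=> ltij ltj; apply: (sorted_ltn_nth ltn_trans 0%N srt) => //; rewrite inE szt //.
  exact: ltn_trans ltj.
have t_ge i : (i < N)%N -> (i <= nth 0 t i)%N.
  elim: i => // i IH lti; have := t_incr i i.+1 (ltnSn i) lti; have := IH (ltnW lti); lia.
pose mu := mkseq (fun j => nth 0 t (N - j.+1) - (N - j.+1))%N N.
have srt_mu : sorted geq mu.
  apply/(sortedP 0%N) => i; rewrite size_mkseq => lti.
  rewrite !nth_mkseq //=; last exact: ltnW.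
  have := t_incr (N - i.+2)%N (N - i.+1)%N; have := t_ge (N - i.+2)%N; lia.
pose la := [seq x <- mu | (0 < x)%N].
have sz_la : (size la <= N)%N.
  by rewrite size_filter (leq_trans (count_size _ _)) // size_mkseq.
have pe (i : 'I_N) : part_exp la i = nth 0%N t i.
  rewrite /part_exp nth_filter_pos // nth_mkseq; last by have := ltn_ord i; lia.
  have -> : (N - (N - i.+1).+1 = i)%N by have := ltn_ord i; lia.
  by rewrite subnK // t_ge.
have tE : t = map (@part_exp N la) (enum 'I_N).
  apply: (@eq_from_nth _ 0%N); first by rewrite szt size_map size_enum_ord.
  move=> i; rewrite szt => lti; rewrite (nth_map (Ordinal lti)) ?size_enum_ord //.
  by rewrite pe nth_enum_ord.
exists la.
  apply/and3P; split.
  - by apply: sorted_filter => // x y z /= h1 h2; apply: leq_trans h2 h1.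
  - exact: filter_all.
  - have := sum_part_exp sz_la.
    have -> : (\sum_(i < N) part_exp la i = \sum_i a i)%N.
      transitivity (sumn t); first by rewrite tE sumnE big_map big_enum.
      by rewrite (perm_sumn pst) sumnE big_map big_enum.
    by rewrite wta => /addIn ->.
have : perm_eq s [tuple part_exp la i | i < N].
  by move: pst; rewrite tE perm_sym.
case/tuple_permP => p sE; exists p => i /=.
have := congr1 (fun u => nth 0%N u i) sE.
rewrite (nth_map i) ?size_enum_ord // nth_ord_enum => ->.
by rewrite -(tnth_nth _ _ i) !tnth_mktuple.
Qed.

(** Vectors with a repeated entry contribute 0; every other one is, in exactly one way, a permuted
    [part_exp la], and squaring removes the sign. *)
Lemma schur_sq_sum_partitions (K : comNzRingType) (h : nat -> K) N n : (n <= N)%N ->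
  schur_sq_sum N h n =
  N`!%:R * \sum_(la <- partitions n) schur h (@part_exp N la) ^+ 2.
Proof.
move=> lenN; rewrite /schur_sq_sum; set wt0 := (\sum_(i < N) i)%N; set L := (wt0 + N).+1.
pose g la (s : 'S_N) : {ffun 'I_N -> 'I_L} := [ffun i => inord (part_exp la (s i))].
have gE la s i : la \in partitions n -> g la s i = part_exp la (s i) :> nat.
  rewrite mem_partitions => part; rewrite ffunE inordK // ltnS.
  have szN := leq_trans (is_partition_size part) lenN.
  have := sum_part_exp szN; case/and3P: part => _ _ /eqP ->.
  rewrite (bigD1 (s i)) //= -/wt0; lia.
transitivity (\sum_(a : {ffun 'I_N -> 'I_L} | (\sum_i (a i : nat) == n + wt0)%N &&
     injectiveb a) schur h (fun i => a i) ^+ 2).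
  rewrite big_mkcondr /=; apply: eq_bigr => a _; case: injectiveP => // ninj.
  have [->|/schur_neq0_inj ainj] := eqVneq (schur h (fun i => a i)) 0.
    by rewrite expr0n.
  by case: ninj => i j eij; apply: ainj; rewrite eij.
rewrite -big_filter.
transitivity (\sum_(a <- [seq g la s | la <- partitions n, s <- enum 'S_N])
   schur h (fun i => a i) ^+ 2); last first.
  rewrite big_allpairs_dep /= mulr_sumr !big_seq; apply: eq_bigr => la lain.
  rewrite big_enum /= (eq_bigr (fun=> schur h (@part_exp N la) ^+ 2)).
    by rewrite sumr_const card_Sn mulr_natl.
  move=> s _; rewrite (eq_schur h (fun i => gE la s i lain)).
  by rewrite (schur_perm h (@part_exp N la) s) exprMn sqrr_sign mul1r.
apply: perm_big; apply: uniq_perm.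
- by rewrite filter_uniq // index_enum_uniq.
- apply: allpairs_uniq; rewrite ?undup_uniq ?enum_uniq //.
  move=> [la s] [mu u] /allpairsP[[la' s'] [/= lain _ [-> ->]]].
  move=> /allpairsP[[mu' u'] [/= muin _ [-> ->]]] {la s mu u} /= eg.
  have ePE i : part_exp la' (s' i) = part_exp mu' (u' i).
    by rewrite -!gE // eg.
  have := lain; rewrite mem_partitions => pla; case/and3P: (pla) => sla posla _.
  have := muin; rewrite mem_partitions => pmu; case/and3P: (pmu) => smu posmu _.
  have srt (nu : seq nat) : sorted geq nu -> sorted ltn (map (@part_exp N nu) (enum 'I_N)).
    move=> snu; apply: (homo_sorted (e := fun i j : 'I_N => (i < j)%N)).
      by move=> i j; apply: part_exp_lt.
    have := iota_ltn_sorted 0 N; rewrite -val_enum_ord sorted_map; exact.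
  (* Both lists are strictly increasing with the same set of values, hence equal; this recovers the
     partition, then the permutation. *)
  have : map (@part_exp N la') (enum 'I_N) = map (@part_exp N mu') (enum 'I_N).
    apply: (irr_sorted_eq ltn_trans ltnn (srt _ sla) (srt _ smu)) => x.
    apply/mapP/mapP => -[i _ ->].
    - exists (u' ((s'^-1)%g i)); first by rewrite mem_enum.
      by rewrite -ePE permKV.
    - exists (s' ((u'^-1)%g i)); first by rewrite mem_enum.
      by rewrite ePE permKV.
  move=> /eq_in_map eP.
  have elm : la' = mu'.
    apply: eq_pos_nth => // i; have [ltiN|leNi] := ltnP i N; last first.
      rewrite !nth_default //; apply: leq_trans leNi; apply: leq_trans lenN;
        exact: is_partition_size.
    have := eP (rev_ord (Ordinal ltiN)); rewrite mem_enum /part_exp /= => /(_ isT).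
    have -> : (N - (N - i.+1).+1 = i)%N by lia.
    by move/addIn.
  rewrite -elm in ePE *; congr (_, _); apply/permP => i.
  exact: part_exp_inj sla _ _ (ePE i).
move=> a; rewrite mem_filter mem_index_enum andbT; apply/andP/allpairsP.
  case=> /eqP wta /injectiveP a_inj.
  have [la part [s eas]] := @partition_of_inj N n (fun i => a i)
     (fun i j e => a_inj i j (val_inj e)) wta.
  have lain : la \in partitions n by rewrite mem_partitions.
  exists (la, s); split => //=; first by rewrite mem_enum.
  by apply/ffunP => i; apply: val_inj; rewrite /= gE // eas.
case=> -[la s] [/= lain _ ->]; have := lain; rewrite mem_partitions => part.
split.
  rewrite (eq_bigr (fun i => part_exp la (s i))); last by move=> i _; apply: gE.
  have -> : (\sum_i part_exp la (s i) = \sum_(i < N) part_exp la i)%N.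
    by rewrite [RHS](reindex_inj (@perm_inj _ s)).
  rewrite sum_part_exp.
    by case/and3P: part => _ _ /eqP ->.
  exact: leq_trans (is_partition_size part) lenN.
apply/injectiveP => i j /(congr1 val); rewrite /= !gE //.
case/and3P: part => srt _ _ /(part_exp_inj srt); exact: perm_inj.
Qed.

Lemma schur_part_exp_size (K : comNzRingType) (h : nat -> K) N la : h 0%N = 1 ->
  (size la <= N)%N -> schur h (@part_exp N la) = schur h (@shift_seq la).
Proof.
move=> h0 /subnK <-; elim: (N - size la)%N => [|m <-] //.
rewrite addSn; apply: schur_pad => // [|i]; rewrite /part_exp.
  by rewrite nth_default // subSS subn0 leq_addl.
by rewrite /= /bump /= subSS addnS.
Qed.

(** * Standard tableaux *)


Section Tableaux.
Variable N : nat.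
Implicit Types (lam : nat -> nat) (x y : 'I_N * 'I_N).

Definition next_cell x y : bool :=
  ((val y.1 == val x.1) && (val y.2 == (val x.2).+1))
  || ((val y.1 == (val x.1).+1) && (val y.2 == val x.2)).

(** The grid size [N] is kept apart from the number [k] of entries, and the shape is a function, so
    that entries can be removed one at a time inside a fixed grid. *)
Definition syt lam k (T : {ffun 'I_k -> 'I_N * 'I_N}) : bool :=
  [&& injectiveb T, [forall j, ((T j).2 < lam (T j).1)%N] &
      [forall j, forall l, next_cell (T j) (T l) ==> (j < l)%N]].

Definition shape lam :=
  (forall i, lam i.+1 <= lam i)%N /\ (forall i, (N <= i)%N -> lam i = 0%N).

Definition remove_cell lam (r : nat) : nat -> nat :=
  fun i => if i == r then (lam i).-1 else lam i.

Definition row_exp lam (i : 'I_N) : nat := (lam (N - i.+1) + i)%N.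

Definition snoc k (T : {ffun 'I_k -> 'I_N * 'I_N}) x : {ffun 'I_k.+1 -> 'I_N * 'I_N} :=
  [ffun j => if unlift ord_max j is Some i then T i else x].

Lemma snoc_lift k (T : {ffun 'I_k -> 'I_N * 'I_N}) x j :
  snoc T x (lift ord_max j) = T j.
Proof. by rewrite ffunE liftK. Qed.

Lemma snoc_max k (T : {ffun 'I_k -> 'I_N * 'I_N}) x : snoc T x ord_max = x.
Proof. by rewrite ffunE unlift_none. Qed.

Lemma sytP lam k (T : {ffun 'I_k -> 'I_N * 'I_N}) :
  reflect [/\ injective T, forall j, ((T j).2 < lam (T j).1)%N &
             forall j l, next_cell (T j) (T l) -> (j < l)%N] (syt lam T).
Proof.
apply: (iffP and3P) => -[h1 h2 h3]; split.
- exact/injectiveP.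
- exact/forallP.
- by move=> j l; apply/implyP; move/forallP/(_ j)/forallP: h3.
- exact/injectiveP.
- exact/forallP.
- by apply/forallP => j; apply/forallP => l; apply/implyP/h3.
Qed.

Lemma shape_le lam i : shape lam -> (lam i <= \sum_(i < N) lam i)%N.
Proof.
case=> _ lam0; have [lti|/lam0->//] := ltnP i N.
by rewrite (bigD1 (Ordinal lti)) //= leq_addr.
Qed.

(** The image of [T] lies in the diagram, and both have [k] elements. *)
Lemma syt_onto lam k (T : {ffun 'I_k -> 'I_N * 'I_N}) x : shape lam ->
  (\sum_(i < N) lam i = k)%N -> (k <= N)%N -> syt lam T ->
  (x.2 < lam x.1)%N -> exists j, T j = x.
Proof.
move=> sh wt lekN /sytP[T_inj Tin _] xin.
pose C := [set y : 'I_N * 'I_N | (y.2 < lam y.1)%N].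
have cardC : #|C| = k.
  rewrite -wt -sum1_card (eq_bigl (fun y : 'I_N * 'I_N => (y.2 < lam y.1)%N)); last first.
    by move=> y; rewrite inE.
  rewrite -(pair_big_dep predT (fun r c : 'I_N => (c < lam r)%N) (fun _ _ => 1%N)) /=.
  apply: eq_bigr => r _.
  rewrite -(big_ord_widen N (fun=> 1%N)) ?sum1_card ?card_ord //.
  by apply: leq_trans (shape_le r sh) _; rewrite wt.
have sTC : [set T j | j in 'I_k] \subset C.
  by apply/subsetP => y /imsetP[j _ ->]; rewrite inE.
have : [set T j | j in 'I_k] = C.
  by apply/eqP; rewrite eqEcard sTC card_imset // cardC card_ord leqnn.
move/setP/(_ x); rewrite inE xin => /imsetP[j _ ->]; by exists j.
Qed.

Lemma next_cell_irr x : next_cell x x = false.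
Proof. by rewrite /next_cell; lia. Qed.

(** The largest entry sits in a corner: a cell to its right or below it would be filled, by
    [syt_onto], with a still larger entry. *)
Lemma syt_snoc lam k (T : {ffun 'I_k -> 'I_N * 'I_N}) x : shape lam ->
  (\sum_(i < N) lam i = k.+1)%N -> (k.+1 <= N)%N ->
  syt lam (snoc T x) =
  [&& x.2.+1 == lam x.1, (lam x.1.+1 < lam x.1)%N & syt (remove_cell lam x.1) T].
Proof.
move=> sh wt lekN; have [lamS lam0] := sh.
have leN i : (lam i <= N)%N by apply: leq_trans (shape_le i sh) _; rewrite wt.
apply/idP/and3P => [sytT|[/eqP ex corner /sytP[T_inj Tin Tord]]].
  have /sytP[T_inj Tin Tord] := sytT.
  have xin : (x.2 < lam x.1)%N by have := Tin ord_max; rewrite snoc_max.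
  have maximal y : (y.2 < lam y.1)%N -> next_cell x y = false.
    move=> yin; have [l Tl] := syt_onto sh wt lekN sytT yin.
    apply/negP => nxt; have := Tord ord_max l; rewrite Tl snoc_max => /(_ nxt).
    by have := ltn_ord l; rewrite /= ; lia.
  have ex : x.2.+1 == lam x.1.
    apply: contraT => nex; have lt2 : (x.2.+1 < lam x.1)%N by lia.
    have ltN : (x.2.+1 < N)%N by apply: leq_trans lt2 (leN _).
    by have := maximal (x.1, Ordinal ltN) lt2; rewrite /next_cell /= !eqxx.
  have corner : (lam x.1.+1 < lam x.1)%N.
    rewrite ltnNge; apply/negP => ge1; have lt2 : (x.2 < lam x.1.+1)%N by lia.
    have ltN : (x.1.+1 < N)%N.
      by rewrite ltnNge; apply/negP => /lam0 e0; rewrite e0 in lt2.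
    by have := maximal (Ordinal ltN, x.2) lt2; rewrite /next_cell /= !eqxx orbT.
  split=> //; apply/sytP; split.
  - move=> i j eij; have := T_inj (lift ord_max i) (lift ord_max j).
    by rewrite !snoc_lift => /(_ eij) /lift_inj.
  - move=> j; have := Tin (lift ord_max j); rewrite snoc_lift /remove_cell.
    case: eqP => // e1 lt2.
    have : T j <> x.
      move=> ejx; have := T_inj (lift ord_max j) ord_max.
      rewrite snoc_lift snoc_max => /(_ ejx) /eqP.
      by rewrite eq_sym (negbTE (neq_lift _ _)).
    case: (T j) x e1 lt2 ex {sytT Tin Tord T_inj xin maximal corner} => a b [c d] /=.
    move=> /val_inj -> lt2 ex ne; have : b != d :> nat.
      by apply/eqP => /val_inj ebd; rewrite ebd in ne.
    by move: ex => /eqP; lia.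
  - move=> j l nxt; have := Tord (lift ord_max j) (lift ord_max l).
    by rewrite !snoc_lift !lift_max; apply.
have TinL j : ((T j).2 < lam (T j).1)%N.
  by have := Tin j; rewrite /remove_cell; case: eqP => // _; lia.
have Tnx j : T j <> x.
  by move=> e; have := Tin j; rewrite e /remove_cell eqxx -ex /= ltnn.
apply/sytP; split.
- move=> i j; case: (unliftP ord_max i) => [i'|] ->; case: (unliftP ord_max j) => [j'|] ->.
  + by rewrite !snoc_lift => /T_inj ->.
  + by rewrite snoc_lift snoc_max => /Tnx.
  + by rewrite snoc_lift snoc_max => /esym/Tnx.
  + by [].
- move=> j; case: (unliftP ord_max j) => [j'|] ->; first by rewrite snoc_lift.
  by rewrite snoc_max -ex.
- move=> j l; case: (unliftP ord_max j) => [j'|] ->; case: (unliftP ord_max l) => [l'|] ->.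
  + by rewrite !snoc_lift !lift_max; apply: Tord.
  + by move=> _; rewrite lift_max.
  + rewrite snoc_lift snoc_max; have := TinL l'; have := Tin l'; rewrite /remove_cell.
    move: (T l') => [a b] /= h1 h2 /orP[]/= /andP[/eqP e1 /eqP e2].
      by move: h1 h2; rewrite e1 eqxx e2; lia.
    by move: h2; rewrite e1 e2; lia.
  + by rewrite snoc_max next_cell_irr.
Qed.

Lemma card_syt_rec lam k : shape lam ->
  (\sum_(i < N) lam i = k.+1)%N -> (k.+1 <= N)%N ->
  #|[pred T : {ffun 'I_k.+1 -> 'I_N * 'I_N} | syt lam T]| =
  (\sum_(r < N | (lam r.+1 < lam r)%N)
     #|[pred T : {ffun 'I_k -> 'I_N * 'I_N} | syt (remove_cell lam r) T]|)%N.
Proof.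
move=> sh wt lekN.
have leN i : (lam i <= N)%N by apply: leq_trans (shape_le i sh) _; rewrite wt.
rewrite -sum1_card /=.
rewrite (reindex (fun q : ('I_N * 'I_N) * {ffun 'I_k -> 'I_N * 'I_N} => snoc q.2 q.1)) /=;
  last first.
  exists (fun T : {ffun 'I_k.+1 -> 'I_N * 'I_N} =>
      (T ord_max, [ffun j => T (lift ord_max j)])).
    move=> [x T] _ /=; rewrite snoc_max; congr (_, _).
    by apply/ffunP => j; rewrite ffunE snoc_lift.
  move=> T _ /=; apply/ffunP => j.
  by case: (unliftP ord_max j) => [j'|] ->; rewrite ?snoc_lift ?snoc_max ?ffunE.
transitivity (\sum_(x : 'I_N * 'I_N) \sum_(T : {ffun 'I_k -> 'I_N * 'I_N} |
    [&& x.2.+1 == lam x.1, (lam x.1.+1 < lam x.1)%N & syt (remove_cell lam x.1) T]) 1)%N.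
  rewrite pair_big_dep /=; apply: eq_bigl => -[x T] /=.
  by rewrite inE /= (syt_snoc _ _ sh wt lekN).
rewrite -(pair_big predT predT (fun r c : 'I_N =>
  \sum_(T : {ffun 'I_k -> 'I_N * 'I_N} | [&& c.+1 == lam r, (lam r.+1 < lam r)%N
     & syt (remove_cell lam r) T]) 1)%N) /= [RHS]big_mkcond.
apply: eq_bigr => r _; case: ifP => corner; last first.
  by rewrite big1 // => c _; rewrite big_pred0 // => T; rewrite andbF.
(* The row of a corner determines its column, [lam r - 1]. *)
have ltc : ((lam r).-1 < N)%N by have := leN r; lia.
rewrite (bigD1 (Ordinal ltc)) //= [X in (_ + X)%N]big1 => [|c nc]; last first.
  rewrite big_pred0 // => T; apply/negbTE/negP => /andP[/eqP e _].
  by move: nc; rewrite -val_eqE /= -e eqxx.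
rewrite addn0 -sum1_card; apply: eq_bigl => T; rewrite inE /=.
by rewrite prednK ?eqxx //; lia.
Qed.

(** * Frobenius' determinant formula for the number of standard tableaux *)

Section Frobenius.
Variable R : fieldType.
Hypothesis charR0 : [pchar R] =i pred0.

Definition inv_fact (m : nat) : R := (m`!%:R)^-1.

Lemma natr_neq0 m : (0 < m)%N -> m%:R != 0 :> R.
Proof. by move=> m0; rewrite ((pcharf0P R).1 charR0) -lt0n. Qed.

Lemma inv_fact0 : inv_fact 0 = 1.
Proof. by rewrite /inv_fact fact0 invr1. Qed.

Lemma inv_factS m : m.+1%:R * inv_fact m.+1 = inv_fact m.
Proof.
rewrite /inv_fact factS natrM invfM mulrA divff ?mul1r //; exact: natr_neq0.
Qed.

(** The series is [exp t], whose logarithmic derivative is 1. *)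
Lemma newton_inv_fact : newton inv_fact (fun k => (k == 0%N)%:R).
Proof.
case=> [|m]; first by rewrite big_ord0 mul0r.
rewrite inv_factS big_ord_recl /= mul1r subSS subn0 big1 ?addr0 // => i _.
by rewrite mul0r.
Qed.

(** Only the lowering by 1 survives in Euler's identity. In a row that is not a corner it makes two
    exponents equal, so the determinant vanishes. *)
Lemma schur_row_rec lam k : shape lam -> (\sum_(i < N) lam i = k.+1)%N ->
  k.+1%:R * schur inv_fact (row_exp lam) =
  \sum_(r < N | (lam r.+1 < lam r)%N) schur inv_fact (row_exp (remove_cell lam r)).
Proof.
move=> [lamS lam0] wt; set a := row_exp lam.
have leL i : (a i <= (\sum_i a i).+1)%N.
  by apply: leqW; rewrite (bigD1 i) //= leq_addr.
have := schur_euler newton_inv_fact leL.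
have -> : (\sum_i a i = k.+1 + \sum_(i < N) i)%N.
  by rewrite big_split /= -wt [in RHS](reindex_inj rev_ord_inj).
rewrite natrD addrK => ->; rewrite big_ord_recl /= mul1r [X in _ + X]big1 ?addr0; last first.
  by move=> i _; rewrite mul0r.
rewrite (reindex_inj rev_ord_inj) big_mkcond [RHS]big_mkcond /=.
apply: eq_bigr => r _.
have aE : a (rev_ord r) = (lam r + (N - r.+1))%N.
  by rewrite /a /row_exp /=; congr (lam _ + _)%N; have := ltn_ord r; lia.
case: (ltnP (lam r.+1)) => corner.
  rewrite ifT; last by rewrite aE; lia.
  apply: eq_schur => l; rewrite /update /remove_cell; case: eqP => [->|ne].
    rewrite aE /row_exp /=.
    have -> : (N - (N - r.+1).+1 = r)%N by have := ltn_ord r; lia.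
    by rewrite eqxx; lia.
  rewrite /a /row_exp; case: eqP => // e; case: ne; apply: val_inj => /=.
  by have := ltn_ord l; lia.
case: ifP => // a_gt0.
(* In the last row, not being a corner means [lam r = 0]; the exponent is then already 0 and cannot
   be lowered. *)
have [lastr|ltr] := leqP N r.+1.
  by move: a_gt0; rewrite aE; have := lam0 _ lastr; lia.
have lti : (N - r.+2 < N)%N by lia.
apply: (@schur_eq0 _ _ _ _ (rev_ord r) (Ordinal lti)).
  by rewrite -val_eqE /=; lia.
rewrite /update eqxx ifF; last by rewrite -val_eqE /=; lia.
rewrite aE /a /row_exp /=; have := lamS r.
have -> : (N - (N - r.+2).+1 = r.+1)%N by lia.
lia.
Qed.

Lemma shape_remove_cell lam (r : 'I_N) : shape lam -> (lam r.+1 < lam r)%N ->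
  shape (remove_cell lam r).
Proof.
case=> lamS lam0 corner; split=> i; rewrite /remove_cell.
  have := lamS i; case: eqP => [->|_]; case: eqP => [e|_]; try lia.
  by rewrite e in corner *; lia.
by move=> leNi; rewrite lam0 //; case: eqP.
Qed.

Lemma sum_remove_cell lam (r : 'I_N) : (0 < lam r)%N ->
  (\sum_(i < N) lam i = (\sum_(i < N) remove_cell lam r i).+1)%N.
Proof.
move=> lam_gt0; rewrite (bigD1 r) //= [in RHS](bigD1 r) //= /remove_cell eqxx.
rewrite -addSn prednK //; congr (_ + _)%N; apply: eq_bigr => i ne.
by rewrite ifF //; apply: negbTE.
Qed.

(* Tableaux and [k! det(1 / (a_i - j)!)] obey the same branching rule. *)
Lemma card_syt k lam : shape lam -> (\sum_(i < N) lam i = k)%N -> (k <= N)%N ->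
  #|[pred T : {ffun 'I_k -> 'I_N * 'I_N} | syt lam T]|%:R
  = k`!%:R * schur inv_fact (row_exp lam).
Proof.
elim: k lam => [|k IH] lam sh wt lekN.
  have lamE i : lam i = 0%N by have := shape_le i sh; rewrite wt; lia.
  rewrite (eq_schur _ (b := fun i => i)); last by move=> i; rewrite /row_exp lamE.
  rewrite schur_id ?inv_fact0 // mulr1 fact0; congr (_%:R).
  have sytT (T : {ffun 'I_0 -> 'I_N * 'I_N}) : syt lam T.
    by apply/sytP; split; [case|case|case].
  rewrite (eq_card (B := predT)); last by move=> T; rewrite !inE sytT.
  by rewrite card_ffun card_ord expn0.
rewrite card_syt_rec // natr_sum factS [(_ * _)%N]mulnC natrM -mulrA (schur_row_rec sh wt).
rewrite mulr_sumr; apply: eq_bigr => r corner.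
apply: IH; [exact: shape_remove_cell| | exact: ltnW].
by have := sum_remove_cell (leq_ltn_trans (leq0n _) corner); rewrite wt => -[].
Qed.

End Frobenius.
End Tableaux.

Lemma num_syt_schur (R : fieldType) (charR0 : [pchar R] =i pred0) n la :
  is_partition n la ->
  (num_syt la)%:R = n`!%:R * schur (@inv_fact R) (@part_exp n la).
Proof.
move=> part; have sz := is_partition_size part.
case/and3P: part => srt _ /eqP sum; rewrite /num_syt sum.
rewrite -(@card_syt n R charR0 n (nth 0%N la)) //.
- congr (_%:R); apply: eq_card => T; rewrite !inE /is_syt /syt.
  congr [&& _, _ & _]; apply: eq_forallb => k; rewrite /in_shape /=.
  by case: (ltnP _ (size la)) => // le; rewrite nth_default.
- split=> i; first exact: sorted_geq_nth.
  by move=> leni; rewrite nth_default // (leq_trans sz).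
- by rewrite sumn_nth.
Qed.

(** * Appell sequences *)


Section Convolution.
Variable K : comNzRingType.
Implicit Types h p : nat -> K.

Definition conv h1 h2 (m : nat) : K := \sum_(k < m.+1) h1 k * h2 (m - k)%N.

Lemma convC h1 h2 m : conv h1 h2 m = conv h2 h1 m.
Proof.
rewrite /conv (reindex_inj rev_ord_inj); apply: eq_bigr => k _ /=.
by rewrite mulrC subSS subKn // -ltnS.
Qed.

Lemma conv_newton_l h1 h2 p m : newton h1 p ->
  conv (fun k => k%:R * h1 k) h2 m = \sum_(l < m) p l * conv h1 h2 (m - l.+1).
Proof.
move=> hp; rewrite /conv big_ord_recl !mul0r add0r.
transitivity (\sum_(k < m) \sum_(l < m | (l < k.+1)%N)
    p l * (h1 (k - l)%N * h2 (m - k.+1)%N)).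
  apply: eq_bigr => k _; rewrite /= /bump /= add1n hp mulr_suml.
  rewrite (big_ord_widen m (fun l => p l * h1 (k.+1 - l.+1)%N * h2 (m - k.+1)%N)) //.
  by apply: eq_bigr => l _; rewrite mulrA subSS.
rewrite (exchange_big_dep predT) //=; apply: eq_bigr => l _; rewrite -mulr_sumr.
congr (_ * _).
transitivity (\sum_(l <= k < m) h1 (k - l)%N * h2 (m - k.+1)%N).
  by rewrite big_geq_mkord.
rewrite -{1}[l : nat]add0n big_addn big_mkord.
have -> : (m - l = (m - l.+1).+1)%N by have := ltn_ord l; lia.
by apply: eq_bigr => k _; rewrite addnK; congr (_ * h2 _); lia.
Qed.

(** Logarithmic derivatives add under products: write [m = k + (m - k)] and apply each recursion to
    its own factor. *)
Lemma newton_conv h1 h2 p1 p2 : newton h1 p1 -> newton h2 p2 ->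
  newton (conv h1 h2) (fun k => p1 k + p2 k).
Proof.
move=> hp1 hp2 m.
under eq_bigr do rewrite mulrDl.
rewrite big_split /= -(conv_newton_l h2 m hp1).
under [X in _ + X]eq_bigr do rewrite convC.
rewrite -(conv_newton_l h1 m hp2) [X in _ + X]convC.
rewrite /conv -big_split mulr_sumr; apply: eq_bigr => k _ /=.
have lek : (k <= m)%N by rewrite -ltnS.
by rewrite -{1}(subnKC lek) natrD; ring.
Qed.

End Convolution.

(** * Newton's recursion for the exponential of a series *)

Section ExpSeries.
Variable R : fieldType.
Hypothesis charR0 : [pchar R] =i pred0.
Variable g : nat -> R.
Hypothesis g0 : g 0%N = 0.

Lemma coef_trunc_exp n m j i : (i <= m)%N -> (m <= n)%N ->
  (trunc_series g n ^+ j)`_i = (trunc_series g m ^+ j)`_i.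
Proof.
move=> + lemn; elim: j i => [|j IH] i leim; first by rewrite !expr0.
rewrite !exprS !coefM; apply: eq_bigr => l _.
rewrite IH; last by lia.
by rewrite !coef_poly; have := ltn_ord l => ltl; rewrite !ifT //; lia.
Qed.

Lemma coef_trunc_exp_small n j i : (i < j)%N -> (trunc_series g n ^+ j)`_i = 0.
Proof.
elim: j i => // j IH i ltij; rewrite exprS coefM big_ord_recl coef_poly /= g0 mul0r add0r.
by apply: big1 => l _; rewrite IH ?mulr0 //= /bump; have := ltn_ord l; lia.
Qed.

(** One truncation level serves all coefficients up to [n], so the exponential can be differentiated
    as a single polynomial. *)
Lemma exp_coefE n m : (m <= n)%N ->
  exp_coef g m = (\sum_(j < n.+1) inv_fact R j *: trunc_series g n ^+ j)`_m.
Proof.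
move=> lemn; rewrite /exp_coef !coef_sum.
rewrite (big_ord_widen n.+1 (fun j => ((j`!%:R)^-1 *: trunc_series g m ^+ j)`_m)) //.
rewrite big_mkcond; apply: eq_bigr => j _; rewrite !coefZ.
rewrite (coef_trunc_exp j (leqnn m) lemn); case: ltnP => // ltmj.
by rewrite coef_trunc_exp_small ?mulr0.
Qed.

Lemma exp_coef0 : exp_coef g 0 = 1.
Proof. by rewrite /exp_coef big_ord1 fact0 invr1 scale1r expr0 coef1. Qed.

Lemma newton_exp_coef : newton (exp_coef g) (fun k => k.+1%:R * g k.+1).
Proof.
case=> [|m]; first by rewrite big_ord0 mul0r.
rewrite (exp_coefE (leqnn _)) mulr_natl -coef_deriv.
set T := trunc_series g m.+1; set E := \sum_(_ < _) _.
(* The truncated exponential satisfies [E' = T' E] up to its top term, a multiple of [T ^+ m.+1],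
   which has no coefficient in degree at most [m] since [g 0 = 0]. *)
have -> : E^`() = T^`() * (E - inv_fact R m.+1 *: T ^+ m.+1).
  rewrite {1}/E big_ord_recl expr0 derivD derivZ derivC scaler0 add0r raddf_sum.
  rewrite /E [in RHS]big_ord_recr /= addrK mulr_sumr; apply: eq_bigr => j _.
  rewrite derivZ deriv_exp /= /bump /= add1n -[_ *+ j.+1]scaler_nat.
  by rewrite scalerA mulrC (inv_factS charR0) scalerAr.
rewrite mulrBr coefB -scalerAr coefZ [X in _ - _ * X](_ : _ = 0).
  rewrite mulr0 subr0 coefM; apply: eq_bigr => k _; rewrite subSS.
  rewrite (@exp_coefE m.+1) ?coef_deriv; last by rewrite leqW // leq_subr.
  by rewrite coef_poly ltnS ltn_ord mulr_natl.
rewrite mulrC coefM big1 // => j _; rewrite coef_trunc_exp_small ?mul0r //.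
Qed.

End ExpSeries.

(** * Appell polynomials as complete symmetric functions *)

Section Appell.
Variable R : fieldType.
Hypothesis charR0 : [pchar R] =i pred0.

(** These are the coefficients of [f(t) exp(q t)]. The argument [q] is ['X] on the Wronskian side
    and [('X + c_1)^2] for the right-hand side of the theorem. *)
Definition appell_egf (f : nat -> R) (q : {poly R}) : nat -> {poly R} :=
  conv (fun k => (f k)%:P) (fun k => inv_fact R k *: q ^+ k).

Lemma appell_egfE f q m : appell f m \Po q = m`!%:R *: appell_egf f q m.
Proof.
rewrite /appell /appell_egf /conv scaler_sumr raddf_sum; apply: eq_bigr => k _.
by rewrite /= comp_polyZ comp_Xn_poly mul_polyC !scalerA /inv_fact; congr (_ *: _); ring.
Qed.

Lemma newton_monomials (q : {poly R}) :
  newton (fun k => inv_fact R k *: q ^+ k) (fun k => if k == 0%N then q else 0).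
Proof.
case=> [|m]; first by rewrite big_ord0 mul0r.
rewrite big_ord_recl /= subSS subn0 big1 ?addr0; last by move=> i _; rewrite mul0r.
by rewrite mulr_natl -scaler_nat scalerA (inv_factS charR0) exprS scalerAr.
Qed.

Lemma newton_polyC (f p : nat -> R) : newton f p ->
  newton (fun k => (f k)%:P) (fun k => (p k)%:P).
Proof.
move=> fp m; rewrite -polyC_natr -polyCM fp rmorph_sum.
by apply: eq_bigr => k _; rewrite /= polyCM.
Qed.

Lemma newton_appell_egf f p q : newton f p ->
  newton (appell_egf f q) (fun k => (p k)%:P + if k == 0%N then q else 0).
Proof.
by move=> fp; apply: newton_conv (newton_polyC fp) (newton_monomials q).
Qed.

Lemma appell_egf0 f q : f 0%N = 1 -> appell_egf f q 0 = 1.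
Proof.
by move=> f0; rewrite /appell_egf /conv big_ord1 f0 mul1r inv_fact0 scale1r expr0.
Qed.

Lemma deriv_appell_egf f m :
  (appell_egf f 'X m.+1)^`() = appell_egf f 'X m.
Proof.
rewrite /appell_egf /conv big_ord_recr /= derivD subnn expr0 mul_polyC.
rewrite !derivZ -polyC1 derivC !scaler0 addr0 raddf_sum.
apply: eq_bigr => k _; have lek : (k <= m)%N by rewrite -ltnS.
rewrite /= !mul_polyC !derivZ derivXn subSn //= -(inv_factS charR0 (m - k)).
by rewrite -['X^_ *+ _]scaler_nat !scalerA; congr (_ *: _); ring.
Qed.

(** Dividing by [m!] turns the Appell rule into [h_m' = h_(m-1)], so Wronskian entries become
    Jacobi-Trudi entries. *)
Lemma derivn_appell_egf f m i :
  (appell_egf f 'X m)^`(i) = hsub (appell_egf f 'X) m i.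
Proof.
elim: i m => [|i IH] m; first by rewrite /hsub /= subn0.
case: m => [|m]; last by rewrite derivSn deriv_appell_egf IH /hsub ltnS subSS.
rewrite derivSn /hsub /= /appell_egf /conv big_ord1 subnn expr0 mul_polyC !derivZ.
by rewrite -polyC1 derivC !scaler0 linear0.
Qed.

Lemma det_scale_rows (K : comNzRingType) r (d : 'I_r -> K) (A : 'M[K]_r) :
  \det (\matrix_(i, j) (d i * A i j)) = \prod_i d i * \det A.
Proof.
have -> : \matrix_(i, j) (d i * A i j) = diag_mx (\row_i d i) *m A.
  by apply/matrixP => i j; rewrite mul_diag_mx !mxE.
by rewrite det_mulmx det_diag; congr (_ * _); apply: eq_bigr => i _; rewrite mxE.
Qed.

Lemma wronskian_appell f r (a : 'I_r -> nat) :
  wronskian (fun j => appell f (a j))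
  = (\prod_i (a i)`!%:R) *: schur (appell_egf f 'X) a.
Proof.
rewrite /wronskian -det_tr -mul_polyC rmorph_prod -det_scale_rows.
congr (\det _); apply/matrixP => i j; rewrite !mxE.
by rewrite -[appell _ _]comp_polyXr appell_egfE derivnZ derivn_appell_egf mul_polyC.
Qed.

Definition ffact_poly (j : nat) : {poly R} := \prod_(l < j) ('X - (l%:R)%:P).

Lemma horner_ffact_poly m j : (ffact_poly j).[m%:R] = (m ^_ j)%:R.
Proof.
elim: j => [|j IH]; first by rewrite /ffact_poly big_ord0 hornerC.
rewrite /ffact_poly big_ord_recr /= hornerM IH hornerXsubC ffactnSr natrM.
have [lejm|ltmj] := leqP j m; first by rewrite natrB.
by rewrite ffact_small // !mul0r.
Qed.

(** Falling factorials are monic of degree [j], so a unitriangular matrix carries the Vandermonde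
    matrix to this one. *)
Lemma det_ffact r (a : 'I_r -> nat) :
  \det (\matrix_(i < r, j < r) (a i ^_ j)%:R) = vdm R a.
Proof.
pose C := \matrix_(j < r, l < r) (ffact_poly j)`_l.
have szP j : size (ffact_poly j) = j.+1.
  by rewrite size_prod_XsubC /index_enum -enumT size_enum_ord.
have detC : \det C = 1.
  rewrite det_trig; last first.
    by apply/is_trig_mxP => i j ltij; rewrite mxE nth_default // szP.
  rewrite big1 // => i _; rewrite mxE.
  have /monicP : ffact_poly i \is monic by apply: monic_prod_XsubC.
  by rewrite lead_coefE szP.
rewrite -det_tr.
have -> : (\matrix_(i < r, j < r) ((a i ^_ j)%:R : R))^T
     = C *m Vandermonde r (\row_i (a i)%:R).
  apply/matrixP => j i; rewrite !mxE -horner_ffact_poly (@horner_coef_wide _ r).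
    by apply: eq_bigr => l _; rewrite !mxE.
  by rewrite szP.
rewrite det_mulmx detC mul1r det_Vandermonde /vdm.
by apply: eq_bigr => i _; apply: eq_bigr => j _; rewrite !mxE.
Qed.

Lemma schur_inv_fact r (a : 'I_r -> nat) :
  \prod_i (a i)`!%:R * schur (inv_fact R) a = vdm R a.
Proof.
rewrite -det_ffact /schur -det_scale_rows; congr (\det _).
apply/matrixP => i j; rewrite !mxE /hsub; case: leqP => [leja|ltaj].
  by rewrite -(ffact_fact leja) natrM mulfK // natr_neq0 // fact_gt0.
by rewrite mulr0 ffact_small.
Qed.

Lemma vdm_neq0 r (a : 'I_r -> nat) :
  (forall i j : 'I_r, (i < j)%N -> (a i < a j)%N) -> vdm R a != 0.
Proof.
move=> incr; apply/prodf_neq0 => i _; apply/prodf_neq0 => j ltij.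
by rewrite -natrB ?natr_neq0 ?subn_gt0 ?incr // ltnW ?incr.
Qed.

(** The factorials from the Wronskian and the determinant in Frobenius' formula multiply to the
    Vandermonde product, which cancels the denominator of [appell_schur]. *)
Lemma num_syt_appell_schur f n la : f 0%N = 1 -> is_partition n la ->
  (num_syt la)%:R *: appell_schur (appell f) la
  = n`!%:R *: schur (appell_egf f 'X) (@part_exp n la).
Proof.
move=> f0 part; have sz := is_partition_size part.
rewrite (num_syt_schur charR0 part) /appell_schur wronskian_appell.
rewrite !schur_part_exp_size ?inv_fact0 ?appell_egf0 // !scalerA; congr (_ *: _).
have srt : sorted geq la by case/and3P: part.
have vnz : vdm R (@shift_seq la) != 0.
  by apply: vdm_neq0 => i j; apply: part_exp_lt.
rewrite -!mulrA -[RHS]mulr1; congr (_ * _).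
by rewrite mulrCA [schur _ _ * _]mulrC schur_inv_fact mulVf.
Qed.

(** Both sides satisfy the same recursion with the same initial value. The number of rows [N] stays
    fixed during the induction, so [N!] cancels. *)
Lemma schur_sq_partitions_egf h p b N n : newton h p -> h 0%N = 1 ->
  newton b (fun k => p k ^+ 2) -> b 0%N = 1 -> (n <= N)%N ->
  \sum_(la <- partitions n) schur h (@part_exp N la) ^+ 2 = b n :> {poly R}.
Proof.
move=> hp h0 bp b0.
have nz m : (0 < m)%N -> m%:R != 0 :> {poly R}.
  by move=> m0; rewrite -polyC_natr polyC_eq0 natr_neq0.
elim/ltn_ind: n => -[_ _|n IH lenN].
  rewrite (perm_big [:: [::]]) /=; last first.
    apply: uniq_perm; rewrite ?undup_uniq // => la; rewrite mem_partitions inE.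
    apply/idP/eqP => [/is_partition_size|->//]; by case: la.
  rewrite big_seq1 (eq_schur h (b := fun i => i)) ?schur_id ?expr1n ?b0 // => i.
  by rewrite /part_exp nth_nil.
apply: (mulfI (nz n.+1 isT)); apply: (mulfI (nz _ (fact_gt0 N))).
rewrite mulrCA -schur_sq_sum_partitions // (schur_sq_sum_rec hp h0) // bp mulr_sumr.
apply: eq_bigr => k _; rewrite mulrCA; congr (_ * _).
rewrite schur_sq_sum_partitions; last by lia.
by rewrite IH //; lia.
Qed.

End Appell.

Lemma natr_log_series (R : fieldType) (charR0 : [pchar R] =i pred0)
    (c : nat -> R) k : k.+1%:R * log_series c k.+1 = c k.+1 / k`!%:R.
Proof. by rewrite /log_series mulrCA [_ * _^-1](inv_factS charR0 k). Qed.

Theorem theorem5p3 (R : fieldType) (charR0 : [pchar R] =i pred0)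
    (c : nat -> R) (n : nat) :
  let A := appell (exp_coef (log_series c)) in
  let B := appell (exp_coef (log_series
             (fun k => if (k <= 1)%N then 0 else c k ^+ 2 / ((k.-1)`!)%:R))) in
  \sum_(la <- partitions n)
      (((n`!)%:R)^-1 * ((num_syt la)%:R) ^+ 2) *: (appell_schur A la) ^+ 2
  = B n \Po ('X + (c 1%N)%:P) ^+ 2.
Proof.
move=> A B; rewrite appell_egfE.
set fB := exp_coef _.
have nf : n`!%:R != 0 :> R by rewrite natr_neq0 // fact_gt0.
have hA := newton_appell_egf charR0 'X (newton_exp_coef charR0 (g := log_series c) erefl).
rewrite -(schur_sq_partitions_egf charR0 (N := n) hA) //.
- rewrite scaler_sumr !big_seq; apply: eq_bigr => la; rewrite mem_partitions => part.
  (* Each summand is [(F_la A_la)^2 / n! = (n! s_la)^2 / n! = n! s_la^2]. *)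
  rewrite -scalerA -exprZn (num_syt_appell_schur charR0 _ part) ?exp_coef0 //.
  by rewrite exprZn scalerA; congr (_ *: _); field.
- by rewrite appell_egf0 ?exp_coef0.
- move=> m; rewrite (newton_appell_egf charR0 _ (newton_exp_coef charR0 _)) //.
  apply: eq_bigr => k _; congr (_ * _).
  (* At [k = 0] the series of [B] contributes 0 and [q] gives [('X + c_1)^2]; for [k > 0] both sides
     are [(c_(k+1) / k!)^2]. *)
  rewrite !natr_log_series //; case: (nat_of_ord k) => [|l] /=.
    by rewrite mul0r polyC0 add0r divr1 addrC.
  by rewrite !addr0 -polyC_exp expr_div_n -mulrA -invfM -expr2.
- by rewrite appell_egf0 // /fB exp_coef0.
Qed.
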